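(* Let $E$ be a finite set and $\mathcal{L}$ a set of subsets of $E$ with $|\mathcal{L}|=n$, and suppose the toggle group $T(\mathcal{L})$ acts transitively on $\mathcal{L}$. If $T(\mathcal{L})$ contains a nontrivial cycle of length at most $n-1$, then $T(\mathcal{L})$ is primitive.
   Context: For $e\in E$, the toggle $\tau_e:\mathcal{L}\to\mathcal{L}$ is defined by $\tau_e(X)=X\triangle\{e\}$ if $X\triangle\{e\}\in\mathcal{L}$, and $\tau_e(X)=X$ otherwise. The toggle group $T(\mathcal{L})$ is the subgroup of the symmetric group on $\mathcal{L}$ generated by $\{\tau_e: e\in E\}$; its degree is $|\mathcal{L}|$. A transitive permutation group on $\mathcal{L}$ is primitive if it has no block system whose block size is strictly between $1$ and $|\mathcal{L}|$ (a block being a subset $\mathcal{B}$ with $g(\mathcal{B})=\mathcal{B}$ or $g(\mathcal{B})\cap\mathcal{B}=\emptyset$ for all group elements $g$). *)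

(* Defs.v *)
From HB Require Import structures.
From mathcomp Require Import all_boot all_fingroup all_solvable.

Set Implicit Arguments.
Unset Strict Implicit.
Unset Printing Implicit Defensive.

Local Open Scope group_scope.

Definition symdiff (T : finType) (A B : {set T}) : {set T} :=
  (A :\: B) :|: (B :\: A).

Section Toggle.

Variables (E : finType) (L : {set {set E}}).

(* The family L as a type, so that permutations of L are {perm members}. *)
Definition members : finType := {X : {set E} | X \in L}.

(* insubd X Y is Y when Y \in L and X otherwise. *)
Definition toggle (e : E) (X : members) : members :=
  insubd X (symdiff (val X) [set e]).

Lemma toggleK (e : E) : involutive (toggle e).
Proof.
have symdiffK (Y : {set E}) : symdiff (symdiff Y [set e]) [set e] = Y.
  apply/setP=> x; rewrite !inE.
  by case: (x == e); case: (x \in Y).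
move=> X; apply: val_inj; rewrite /toggle !val_insubd.
have [LX | notLX] := boolP (symdiff (val X) [set e] \in L).
  by rewrite symdiffK (valP X).
by rewrite (negPf notLX).
Qed.

Definition toggle_perm (e : E) : {perm members} := perm (inv_inj (toggleK e)).

Definition toggle_group : {group {perm members}} :=
  <<[set toggle_perm e | e : E]>>%G.

End Toggle.

Definition is_cycle_of_length (T : finType) (k : nat) (s : {perm T}) : Prop :=
  exists x : T, #|porbit s x| = k /\
    forall y : T, y \notin porbit s x -> s y = y.

Definition is_block (T : finType) (G : {group {perm T}}) (B : {set T}) : Prop :=
  forall g : {perm T}, g \in G -> g @: B = B \/ (g @: B) :&: B = set0.

(* The library's primitivity, stated there with invariant partitions of
   nontrivial cardinality, is the one stated with blocks of nontrivial size. *)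
Lemma primitive_blocksP (T : finType) (G : {group {perm T}}) :
    [transitive G, on [set: T] | 'P] ->
  [primitive G, on [set: T] | 'P] <->
  (forall B : {set T}, is_block G B -> ~ (1 < #|B| < #|T|)).
Proof.
move=> trG.
have imG (B : {set T}) (g : {perm T}) : ('P^*)%act B g = g @: B by [].
have cardQ Q (B : {set T}) : partition Q [set: T] -> B \in Q ->
    {in Q, forall C : {set T}, #|C| = #|B|} -> #|T| = (#|Q| * #|B|)%N.
  by move=> pQ _ cQ; rewrite -cardsT (card_uniform_partition cQ pQ).
rewrite /primitive trG negb_exists /=; split=> [/forallP primG B blB | primG].
  case/andP=> B_gt1 B_ltT; pose Q := orbit ('P^*)%act G B.
  have QB : B \in Q by apply: orbit_refl.
  have cQ : {in Q, forall C : {set T}, #|C| = #|B|}.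
    by move=> _ /imsetP[g _ ->]; rewrite imG card_imset //; apply: perm_inj.
  have [x Bx] : exists x, x \in B by apply/card_gt0P; apply: ltnW.
  have pQ : partition Q [set: T].
    apply/and3P; split.
    - apply/eqP/setP=> y; rewrite inE; apply/bigcupP.
      have [g Gg ->] := atransP2 trG (in_setT x) (in_setT y).
      by exists (g @: B); [apply: (mem_orbit ('P^*)%act) | apply: imset_f].
    - apply/trivIsetP=> _ _ /imsetP[g Gg ->] /imsetP[h Gh ->].
      rewrite !imG => neq; rewrite -setI_eq0; apply: contraR neq.
      case/set0Pn=> _ /setIP[/imsetP[u Bu ->] /imsetP[v Bv gu]].
      have [eqB | dis] := blB _ (groupM Gg (groupVr Gh)).
        apply/eqP; rewrite -[in RHS]eqB -imset_comp.
        by apply: eq_imset => z /=; rewrite permM permKV.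
      have: v \in (g * h^-1) @: B :&: B.
        rewrite inE Bv andbT; apply/imsetP; exists u => //.
        by rewrite permM gu permK.
      by rewrite dis inE.
    - by apply/negP=> /cQ; rewrite cards0 => B0; rewrite -B0 in B_gt1.
  have /negP[] := primG Q; apply/and3P; split=> //.
    by apply/actsP=> a Ga Y; apply/orbit_transl/mem_orbit.
  have cT := cardQ _ _ pQ QB cQ; rewrite cardsT.
  have Q_gt0 : 0 < #|Q| by apply/card_gt0P; exists B.
  apply/andP; split; last by rewrite cT ltn_Pmulr.
  by move: B_ltT; rewrite cT -[X in X < _]mul1n ltn_pmul2r // ltnW.
apply/forallP=> Q; apply/and3P=> [[pQ actQ]]; rewrite cardsT => /andP[Q1 QT].
have [/eqP defT tIQ ntQ] := and3P pQ.
have QgB B g : B \in Q -> g \in G -> g @: B \in Q.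
  by move=> QB Gg; rewrite -(imG B g) (actsP actQ).
have blQ B : B \in Q -> is_block G B.
  move=> QB g Gg; have [-> | ne] := eqVneq (g @: B) B; [by left | right].
  by apply/eqP; rewrite setI_eq0; apply: (trivIsetP tIQ) => //; apply: QgB.
have [B QB] : exists B, B \in Q by apply/card_gt0P; apply: ltnW.
have [x Bx] : exists x, x \in B.
  by apply/set0Pn; apply: contraNneq ntQ => <-.
have cQ : {in Q, forall C : {set T}, #|C| = #|B|}.
  move=> C QC; have [y Cy] : exists y, y \in C.
    by apply/set0Pn; apply: contraNneq ntQ => <-.
  have [g Gg def_y] := atransP2 trG (in_setT x) (in_setT y).
  have <- : g @: B = C; last by rewrite card_imset //; apply: perm_inj.
  apply/eqP; apply: contraTT Cy => ne.
  have /disjointFr-> := trivIsetP tIQ _ _ (QgB _ _ QB Gg) QC ne => //.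
  by rewrite def_y; apply: imset_f.
apply: (primG B (blQ B QB)); have cT := cardQ _ _ pQ QB cQ.
have B_gt0 : 0 < #|B| by apply/card_gt0P; exists x.
rewrite cT ltn_Pmull // andbT.
by move: QT; rewrite cT -[X in X < _]muln1 ltn_pmul2l // ltnW.
Qed.

(* Main.v *)
Require Import Defs.
From mathcomp Require Import all_boot all_fingroup all_solvable.

(** Let [r] be a nontrivial invariant equivalence on [L]. Call [e] internal if
    its toggle moves some set inside its [r]-class. Connectedness propagates
    this to all classes: internal toggles preserve every class, external ones
    either fix a class pointwise or translate it onto another class, and the two
    kinds commute. So the toggle group is a central product [N * K], where [N]
    only alters internal coordinates and [K] only external ones.
    A cycle [c = h * k] of length less than [n] fixes some class pointwise;
    comparing coordinates, [h] is trivial on that class, hence everywhere, so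
    [c] lies in [K] and acts on each class as a translation. A power of [c] then
    translates a class onto itself by some nonempty [v], which forces [c] to
    have even length. Translation by [v] also pairs up the
    transpositions making up any external toggle, so [K] consists of even
    permutations, whereas a cycle of even length is odd. *)

Set Implicit Arguments.
Unset Strict Implicit.
Unset Printing Implicit Defensive.

Local Open Scope group_scope.

(** * Symmetric differences and generated groups *)

Lemma in_symdiff (T : finType) (A B : {set T}) x :
  (x \in symdiff A B) = (x \in A) (+) (x \in B).
Proof. by rewrite !inE; case: (x \in A); case: (x \in B). Qed.

Lemma symdiffA (T : finType) : associative (@symdiff T).
Proof. by move=> A B C; apply/setP=> x; rewrite !in_symdiff addbA. Qed.

Lemma symdiffC (T : finType) : commutative (@symdiff T).
Proof. by move=> A B; apply/setP=> x; rewrite !in_symdiff addbC. Qed.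

Lemma symdiffxx (T : finType) (A : {set T}) : symdiff A A = set0.
Proof. by apply/setP=> x; rewrite in_symdiff addbb inE. Qed.

Lemma symdiff0 (T : finType) (A : {set T}) : symdiff A set0 = A.
Proof. by apply/setP=> x; rewrite in_symdiff inE addbF. Qed.

Lemma symdiffKl (T : finType) (A B : {set T}) : symdiff A (symdiff A B) = B.
Proof. by rewrite symdiffA symdiffxx symdiffC symdiff0. Qed.

Lemma symdiffK (T : finType) (A B : {set T}) : symdiff (symdiff A B) B = A.
Proof. by rewrite -symdiffA symdiffxx symdiff0. Qed.

Lemma symdiff_eql (T : finType) (A B : {set T}) :
  (symdiff A B == A) = (B == set0).
Proof.
apply/eqP/eqP=> [AB | ->]; last exact: symdiff0.
by rewrite -(symdiffKl A B) AB symdiffxx.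
Qed.

Lemma gen_ind (gT : finGroupType) (A : {set gT}) (P : gT -> Prop) :
    P 1 -> (forall x a, a \in A -> P x -> P (x * a)) ->
  {in <<A>>, forall x, P x}.
Proof.
move=> P1 PM _ /gen_prodgP[n [c Ac ->]].
elim: n c Ac => [|n IHn] c Ac; first by rewrite big_ord0.
by rewrite big_ord_recr /=; apply: PM => //; apply: IHn => i.
Qed.

(** * Parity of involutions and cycles *)

Lemma even_card_involution (T : finType) (A : {set T}) (f : T -> T) :
    {in A, forall x, f x \in A} -> {in A, cancel f f} ->
    {in A, forall x, f x != x} ->
  ~~ odd #|A|.
Proof.
have [m] := ubnP #|A|; elim: m A => // m IHm A le_m fA fK fN.
have [->|[x Ax]] := set_0Vmem A; first by rewrite cards0.
pose B := A :\ x :\ f x.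
have cA : #|A| = #|B|.+2.
  by rewrite (cardsD1 x) Ax (cardsD1 (f x) (A :\ x)) !inE fN // fA.
rewrite cA /= negbK; apply: IHm.
- by move: le_m; rewrite cA !ltnS => /ltnW.
- move=> y /setD1P[yfx /setD1P[yx Ay]]; rewrite !inE fA // andbT.
  apply/andP; split; last by apply: contraNneq yfx => <-; rewrite fK.
  by apply: contraNneq yx => /(congr1 f); rewrite !fK // => ->.
- by move=> y /setD1P[_ /setD1P[_ Ay]]; apply: fK.
- by move=> y /setD1P[_ /setD1P[_ Ay]]; apply: fN.
Qed.

(** [A] picks one point from each transposition of [s], so [#|A|] counts them. *)
Lemma odd_perm_involution (T : finType) (s : {perm T}) (A : {set T}) :
    involutive s -> {in A, forall x, s x \notin A} ->
    (forall x, s x != x -> (x \in A) || (s x \in A)) ->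
  odd_perm s = odd #|A|.
Proof.
have [m] := ubnP #|A|; elim: m A s => // m IHm A s le_m sK sA mA.
have [A0|[x Ax]] := set_0Vmem A.
  suffices -> : s = 1 by rewrite A0 cards0 odd_perm1.
  apply/permP=> x; rewrite perm1; apply/eqP; apply: contraT => /mA.
  by rewrite A0 !inE.
have xsx : x != s x by apply: contraTneq (sA x Ax) => <-; rewrite negbK.
pose t := tperm x (s x) * s.
have tE y : t y = if (y == x) || (y == s x) then y else s y.
  rewrite permM; case: tpermP => [->|->|/eqP/negPf-> /eqP/negPf->] //.
    by rewrite eqxx sK.
  by rewrite eqxx orbT.
have -> : s = tperm x (s x) * t by rewrite /t mulgA tperm2 mul1g.
rewrite odd_permM odd_tperm xsx (cardsD1 x) Ax oddD; congr (_ (+) _).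
apply: IHm.
- by move: le_m; rewrite (cardsD1 x) Ax.
- move=> y; rewrite !tE; have [->|yx] := eqVneq y x; first by rewrite eqxx.
  have [->|ysx] := eqVneq y (s x); first by rewrite eqxx orbT.
  have /negPf-> : s y != x by apply: contraNneq ysx => <-; rewrite sK.
  have /negPf-> : s y != s x by rewrite (inj_eq perm_inj).
  by rewrite sK.
- move=> y /setD1P[yx Ay]; rewrite tE (negPf yx) /=.
  have [ysx|ysx] := eqVneq y (s x); last first.
    by rewrite !inE (negPf (sA y Ay)) andbF.
  by rewrite ysx (negPf (sA x Ax)) in Ay.
- move=> y; rewrite tE; have [->|yx] /= := eqVneq y x; first by rewrite eqxx.
  have [->|ysx] := eqVneq y (s x); first by rewrite eqxx.
  move/mA; rewrite !inE yx /=; case: (y \in A) => //= ->; rewrite andbT.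
  by apply: contraNneq ysx => <-; rewrite sK.
Qed.

Lemma odd_perm_cycle (T : finType) (s : {perm T}) x :
    (forall y, y \notin porbit s x -> s y = y) ->
  odd_perm s = ~~ odd #|porbit s x|.
Proof.
move=> fixs; set O := porbit s x.
have orb1 y : y \notin O -> porbit s y = [set y].
  move/fixs=> sy; apply/setP=> z; apply/porbitP/set1P => [[i ->]|->].
    by rewrite permX; elim: i => //= i ->.
  by exists 0; rewrite perm1.
have defP : porbits s = O |: [set [set y] | y in ~: O].
  apply/setP=> C; apply/imsetP/setU1P => [[y _ ->]|].
    have [Oy|nOy] := boolP (y \in O); [left | right].
      by apply/eqP; rewrite eq_porbit_mem.
    by rewrite orb1 //; apply: imset_f; rewrite inE.
  case=> [->|/imsetP[y]]; first by exists x.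
  by rewrite inE => nOy ->; exists y; rewrite ?orb1.
have nP : O \notin [set [set y] | y in ~: O].
  apply/imsetP=> [[y]]; rewrite inE => nOy Oy.
  by rewrite Oy set11 in nOy.
(* [odd_perm] compares the parity of [#|T|] with that of the number of orbits. *)
rewrite /odd_perm defP cardsU1 nP card_imset; last exact: set1_inj.
by rewrite -(cardsC O) !oddD; case: (odd _); case: (odd _).
Qed.

(** * Invariant equivalences *)

Lemma primitive_of_equivalences (T : finType) (G : {group {perm T}}) :
    [transitive G, on [set: T] | 'P] ->
    (forall r : rel T, equivalence_rel r ->
       (forall g x y, g \in G -> r (g x) (g y) = r x y) ->
       (exists x y, x != y /\ r x y) -> (exists x y, ~~ r x y) -> False) ->
  [primitive G, on [set: T] | 'P].
Proof.
move=> trG eqG; rewrite /primitive trG negb_exists /=.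
apply/forallP=> Q; apply/and3P=> [[pQ actQ]]; rewrite cardsT => /andP[Q1 QT].
have [/eqP defT tIQ ntQ] := and3P pQ.
have inQ x : x \in cover Q by rewrite defT inE.
have pbG g x : g \in G -> pblock Q (g x) = g @: pblock Q x.
  move=> Gg; apply: (def_pblock tIQ); last by rewrite imset_f ?mem_pblock.
  have := actsP actQ g Gg (pblock Q x).
  by rewrite pblock_mem ?inQ.
have defQ : Q = [set pblock Q x | x : T].
  apply/setP=> B; apply/idP/imsetP=> [QB|[x _ ->]]; last exact: pblock_mem.
  have /set0Pn[x Bx] : B != set0 by apply: contraNneq ntQ => <-.
  by exists x => //; rewrite (def_pblock tIQ QB Bx).
apply: (eqG [rel x y | pblock Q x == pblock Q y]).
- by move=> x y z; split=> //= /eqP->.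
- move=> g x y Gg /=; rewrite !pbG // (inj_eq (imset_inj _)) //.
  exact: perm_inj.
- have /injectivePn[x [y neq eqxy]] : ~~ injectiveb (pblock Q).
    apply/injectiveP=> inj; move: QT.
    by rewrite defQ card_imset // ltnn.
  by exists x, y; split=> //=; apply/eqP.
- case: (pickP [pred xy | pblock Q xy.1 != pblock Q xy.2]) => [[x y] /= ne|eq].
    by exists x, y.
  move: Q1; rewrite defQ ltnNge => /negP[].
  apply/card_le1_eqP=> _ _ /imsetP[x _ ->] /imsetP[y _ ->].
  by move: (eq (x, y)) => /= /negbFE/eqP->.
Qed.

(** Take [z] off the cycle: [s] fixes [z], so it preserves the class of [z]. If that class meets the
    cycle, it contains all of it and every other class is fixed; otherwise it is fixed itself. *)
Lemma cycle_fixes_class (T : finType) (r : rel T) (s : {perm T}) k :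
    equivalence_rel r -> (forall x y, r (s x) (s y) = r x y) ->
    (exists x y, ~~ r x y) -> is_cycle_of_length k s -> k < #|T| ->
  exists x0, forall y, r x0 y -> s y = y.
Proof.
move=> eqr inv [a [b nab]] [x [cO fixs]] ltk.
have [rr rs rt] : [/\ reflexive r, symmetric r & transitive r].
  by case/equivalence_relP: eqr => rr lt; split=> //;
    [move=> u v; apply/idP/idP => /lt <- | move=> u v w /lt ->].
have /subsetPn[z _ nz] : ~~ ([set: T] \subset porbit s x).
  by apply: contraL ltk => /subset_leq_card; rewrite cardsT cO leqNgt.
have sz := fixs z nz.
case: (pickP [pred y | r z y & s y != y]) => [y /andP[rzy sy]|none].
  have Oy : y \in porbit s x by apply: contraR sy => /fixs->.
  have rO w : w \in porbit s x -> r z w.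
    move: Oy; rewrite -eq_porbit_mem => /eqP <- /porbitP[i ->].
    by rewrite permX; elim: i => //= i; rewrite -(inv z) sz.
  have [w nzw] : exists w, ~~ r z w.
    have [rza|] := boolP (r z a); last by exists a.
    by exists b; apply: contra nab => rzb; rewrite (rt z) // rs.
  exists w => v rwv; apply: fixs; apply: contra nzw => /rO rzv.
  by rewrite (rt v) // rs.
by exists z => y rzy; move: (none y); rewrite /= rzy /= => /negbFE/eqP.
Qed.

(** * Internal and external toggles *)

Section InvariantEquivalence.

Variables (E : finType) (L : {set {set E}}).
Local Notation G := (toggle_group L).
Local Notation tog := (@toggle E L).

Hypothesis trans : [transitive G, on [set: members L] | 'P].

Variable r : rel (members L).
Hypothesis eqr : equivalence_rel r.
Hypothesis invr : forall g X Y, g \in G -> r (g X) (g Y) = r X Y.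

Implicit Types (X Y Z : members L) (e f : E).

Let rr : reflexive r. Proof. by case/equivalence_relP: eqr. Qed.
Let rs : symmetric r.
Proof.
by case/equivalence_relP: eqr => _ lt X Y; apply/idP/idP => /lt <-.
Qed.
Let rt : transitive r.
Proof. by case/equivalence_relP: eqr => _ lt X Y Z /lt ->. Qed.

Lemma toggle_permE e X : toggle_perm L e X = tog e X.
Proof. exact: permE. Qed.

Lemma mem_toggle_perm e : toggle_perm L e \in G.
Proof. by apply: mem_gen; apply: imset_f. Qed.

Lemma toggle_moved e X :
  (tog e X != X) = (symdiff (val X) [set e] \in L).
Proof.
rewrite -val_eqE /toggle val_insubd.
case: ifP => _; last by rewrite eqxx.
by rewrite symdiff_eql; apply/set0Pn; exists e; rewrite inE.
Qed.

Lemma val_toggle e X :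
  tog e X != X -> val (tog e X) = symdiff (val X) [set e].
Proof. by rewrite toggle_moved /toggle val_insubd => ->. Qed.

Lemma toggle_rel e X Y : r (tog e X) (tog e Y) = r X Y.
Proof. by rewrite -!toggle_permE invr // mem_toggle_perm. Qed.

(** The three moves put all four corners of a square in [L], so both ways around it are
    available. *)
Lemma toggle_move2C e f X :
    tog e X != X -> tog f X != X -> tog f (tog e X) != tog e X ->
  tog e (tog f X) = tog f (tog e X).
Proof.
move=> eX fX feX.
have val_fe : val (tog f (tog e X)) = symdiff (val (tog f X)) [set e].
  rewrite (val_toggle feX) (val_toggle eX) (val_toggle fX).
  by rewrite -!symdiffA [symdiff [set e] _]symdiffC.
have efX : tog e (tog f X) != tog f X.
  by rewrite toggle_moved -val_fe; apply: valP.
by apply: val_inj; rewrite val_fe (val_toggle efX).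
Qed.

Definition internal e := [exists X, (tog e X != X) && r X (tog e X)].

Lemma internal_toggle e : internal e -> forall X, r X (tog e X).
Proof.
(* [W X]: the class of [X] has a member that [e] moves inside the class. This passes along toggles,
   hence by transitivity to every class. *)
pose W X := exists Y, [/\ r X Y, tog e Y != Y & r Y (tog e Y)].
have W_rel X : W X -> r X (tog e X).
  by case=> Y [rXY _ rYe]; rewrite (rt rXY) // (rt rYe) // toggle_rel rs.
have W_tog f X : W X -> W (tog f X).
  move=> WX; have := W_rel X WX; case: WX => Y [rXY eY rYe] rXe.
  have [rXf|nrXf] := boolP (r X (tog f X)).
    by exists Y; split=> //; rewrite (rt _ rXY) // rs.
  (* A member of the class fixed by [f] would make [f] preserve the class. *)
  have moved Z : r X Z -> tog f Z != Z.
    move=> rXZ; apply: contraNneq nrXf => fZ; rewrite (rt rXZ) //.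
    by rewrite -[X in r X _]fZ toggle_rel rs.
  have fY := moved Y rXY; have feY := moved (tog e Y) (rt rXY rYe).
  exists (tog f Y); rewrite (toggle_move2C eY fY feY) !toggle_rel.
  by rewrite (inj_eq (inv_inj (@toggleK _ _ f))).
case/existsP=> X0 /andP[eX0 rX0] X; apply: W_rel.
have [g Gg ->] := atransP2 trans (in_setT X0) (in_setT X).
elim/gen_ind: g / Gg => [|g _ /imsetP[f _ ->]]; rewrite /= /aperm.
  by rewrite perm1; exists X0.
by rewrite permM toggle_permE; apply: W_tog.
Qed.

(** Were [e] to move [U] and fix a related [V], the image of [U] would stay related to [V], making
    [e] internal. *)
Lemma external_moved e X Y :
  ~~ internal e -> r X Y -> (tog e X != X) = (tog e Y != Y).
Proof.
have half U V : ~~ internal e -> r U V -> tog e U != U -> tog e V != V.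
  move=> ext rUV eU; apply: contra ext => /eqP eV; apply/existsP; exists U.
  by rewrite eU (rt rUV) // -[X in r X _]eV toggle_rel rs.
by move=> ext rXY; apply/idP/idP; apply: half; rewrite // rs.
Qed.

Lemma internal_externalC e f X :
  internal e -> ~~ internal f -> tog e (tog f X) = tog f (tog e X).
Proof.
move=> inte extf; have rel Y := internal_toggle inte Y.
have mvd Y := external_moved extf (rel Y).
have [fX|fX] := eqVneq (tog f X) X.
  by rewrite fX; apply/esym/eqP; move: (mvd X); rewrite fX eqxx => /esym/negbFE.
have [eX|eX] := eqVneq (tog e X) X; last first.
  have feX : tog f (tog e X) != tog e X by rewrite -mvd.
  exact: toggle_move2C eX fX feX.
(* Here [e] fixes [X] and [f] moves it. If [e] moved [Y], the square at [Y] would close up and force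
   [tog e Y = Y]. *)
rewrite eX; set Y := tog f X; apply/eqP; apply: contraT => eY.
have fY : tog f Y != Y by rewrite /Y toggleK eq_sym.
have feY : tog f (tog e Y) != tog e Y by rewrite -mvd.
have := toggle_move2C eY fY feY.
rewrite {1}/Y toggleK eX => /(congr1 (tog f)); rewrite toggleK => YY.
by rewrite -YY eqxx in eY.
Qed.

(** * The central product of the internal and external groups *)

Definition internal_group : {group {perm members L}} :=
  <<[set toggle_perm L e | e in [set e | internal e]]>>%G.
Definition external_group : {group {perm members L}} :=
  <<[set toggle_perm L e | e in [set e | ~~ internal e]]>>%G.
Local Notation N := internal_group.
Local Notation K := external_group.

Lemma external_cent : K \subset 'C(N).
Proof.
rewrite gen_subG; apply/subsetP=> g /imsetP[f]; rewrite inE => extf ->.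
rewrite /= cent_gen; apply/centP=> y /imsetP[e]; rewrite inE => inte ->.
by apply/permP=> X; rewrite !permM !toggle_permE internal_externalC.
Qed.

Lemma toggle_group_mul : G :=: N * K.
Proof.
rewrite -cent_joinEr ?external_cent // /= joing_idl joing_idr /joing -imsetU.
congr <<_>>; apply/setP=> g; apply/imsetP/imsetP=> -[e _ ->]; exists e => //.
by rewrite !inE orbN.
Qed.

Lemma external_group_sub : K \subset G.
Proof. by rewrite toggle_group_mul mulG_subr. Qed.

Lemma internal_group_rel h X : h \in N -> r X (h X).
Proof.
move=> Nh; elim/gen_ind: h / Nh => [|h g /imsetP[e]]; first by rewrite perm1.
rewrite inE => inte -> rXh; rewrite permM toggle_permE.
exact: rt rXh (internal_toggle inte _).
Qed.

Lemma mem_toggle e f X : e != f -> (e \in val (tog f X)) = (e \in val X).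
Proof.
move=> ef; have [->//|fX] := eqVneq (tog f X) X.
by rewrite val_toggle // in_symdiff !inE (negPf ef) addbF.
Qed.

Lemma internal_group_coord h X e :
  h \in N -> ~~ internal e -> (e \in val (h X)) = (e \in val X).
Proof.
move=> Nh exte; elim/gen_ind: h / Nh => [|h g /imsetP[f]].
  by rewrite perm1.
rewrite inE => intf -> IH; rewrite permM toggle_permE mem_toggle //.
by apply: contraNneq exte => ->.
Qed.

Lemma external_group_coord k X e :
  k \in K -> internal e -> (e \in val (k X)) = (e \in val X).
Proof.
move=> Kk inte; elim/gen_ind: k / Kk => [|k g /imsetP[f]].
  by rewrite perm1.
rewrite inE => extf -> IH; rewrite permM toggle_permE mem_toggle //.
by apply: contraNneq extf => <-.
Qed.

(** By [external_moved], an external toggle moves either all members of a class or none, so each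
    generator shifts a class uniformly. *)
Lemma external_group_translate k X Y : k \in K -> r X Y ->
  symdiff (val X) (val (k X)) = symdiff (val Y) (val (k Y)).
Proof.
move=> Kk rXY; elim/gen_ind: k / Kk (Kk) => [|k g /imsetP[f]].
  by rewrite !perm1 !symdiffxx.
rewrite inE => extf -> IH Kkf.
have Kf : toggle_perm L f \in K by apply/mem_gen/imset_f; rewrite inE.
have Kk : k \in K by rewrite -(groupMr _ Kf).
rewrite !permM !toggle_permE.
have rk : r (k X) (k Y) by rewrite invr // (subsetP external_group_sub).
have := external_moved extf rk.
have [->|fX] := eqVneq (tog f (k X)) (k X).
  by move/esym/negbFE/eqP->; apply: IH.
by move/esym=> fY; rewrite (val_toggle fX) (val_toggle fY) !symdiffA IH.
Qed.

Lemma external_group_trans X0 X : exists k Y, [/\ k \in K, r X0 Y & X = k Y].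
Proof.
have [g Gg ->] := atransP2 trans (in_setT X0) (in_setT X).
move: Gg; rewrite toggle_group_mul => /mulsgP[h k Nh Kk ->].
by exists k, (h X0); split; rewrite ?internal_group_rel //= /aperm permM.
Qed.

Lemma fixes_class_external c X0 :
  c \in G -> (forall Y, r X0 Y -> c Y = Y) -> c \in K.
Proof.
rewrite toggle_group_mul => /mulsgP[h k Nh Kk ->] fixc.
suffices -> : h = 1 by rewrite mul1g.
(* [k] preserves internal coordinates and [h] external ones, so [k (h Y) = Y] determines both kinds
   of coordinates of [h Y]. *)
have fixh Y : r X0 Y -> h Y = Y.
  move/fixc; rewrite permM => kh; apply/val_inj/setP=> e.
  have [inte|exte] := boolP (internal e); last exact: internal_group_coord.
  by rewrite -[in RHS]kh (external_group_coord _ Kk).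
apply/permP=> X; rewrite perm1.
(* The images of the class of [X0] under [K] cover [L], and [h] commutes with [K]. *)
have [k1 [Y [Kk1 rY ->]]] := external_group_trans X0 X.
by rewrite -permM (centsP external_cent k1 Kk1 h Nh) permM fixh.
Qed.

(** * Translation of a class onto itself *)

Section SelfTranslation.

Variables (d : {perm members L}) (x0 : members L).
Hypotheses (Kd : d \in K) (x0d : r x0 (d x0)) (dx0 : d x0 != x0).
Let v := symdiff (val x0) (val (d x0)).

(** [d] adds [v] both to [x0] and to the related [d x0], so the two shifts cancel; commutation
    carries this to [k x0]. *)
Lemma self_translation_inv k :
  commute d k -> d (d (k x0)) = k x0.
Proof.
move=> com; have dk z : d (k z) = k (d z) by rewrite -!permM com.
have dd : d (d x0) = x0.
  apply: val_inj; have := external_group_translate Kd x0d.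
  move/(congr1 (symdiff (val (d x0)))).
  by rewrite symdiffKl symdiffC symdiffK => <-.
by rewrite !dk dd.
Qed.

(** With [X = k Y] and [Y] in the class of [x0], the members [Y] and [d Y] differ by [v], and [k]
    shifts both by the same set. *)
Lemma class_translation X :
  exists X', [/\ r X X', X' != X & val X' = symdiff (val X) v].
Proof.
have [k [Y [Kk rY ->]]] := external_group_trans x0 X.
have rel g A B : g \in K -> r (g A) (g B) = r A B.
  by move=> Kg; rewrite invr // (subsetP external_group_sub).
have rYd : r Y (d Y).
  by apply: (@rt x0); [rewrite rs | rewrite (rt x0d) // rel].
have valE : val (k (d Y)) = symdiff (val (k Y)) v.
  rewrite /v (external_group_translate Kd rY).
  have := external_group_translate Kk rYd.
  move/(congr1 (symdiff (val (d Y)))); rewrite symdiffKl => <-.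
  by rewrite symdiffC [symdiff (val Y) (val (k Y))]symdiffC -symdiffA.
exists (k (d Y)); split; [by rewrite (rel k) | | exact: valE].
rewrite -val_eqE valE symdiff_eql; apply: contra dx0 => /eqP v0.
by rewrite -val_eqE -(symdiffKl (val x0) (val (d x0))) -/v v0 symdiff0.
Qed.

Lemma external_toggle_even e : ~~ internal e -> ~~ odd_perm (toggle_perm L e).
Proof.
(* [A] takes the member containing [e] from each transposition. *)
move=> exte; pose A := [set X | (tog e X != X) && (e \in val X)].
have flip X : tog e X != X -> (e \in val (tog e X)) = (e \notin val X).
  by move=> eX; rewrite (val_toggle eX) in_symdiff !inE eqxx addbT.
have moved2 X : (tog e (tog e X) != tog e X) = (tog e X != X).
  by rewrite toggleK eq_sym.
rewrite (@odd_perm_involution _ _ A); first last.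
- move=> X; rewrite !toggle_permE !inE moved2 => eX.
  by rewrite eX flip //=; case: (_ \in _).
- move=> X; rewrite toggle_permE !inE moved2 => /andP[eX Xe].
  by rewrite flip // Xe andbF.
- by move=> X; rewrite !toggle_permE toggleK.
(* Translation by [v :\ e] keeps the coordinate [e], so it pairs up [A]. *)
pose w := v :\ e; pose f X : members L := insubd X (symdiff (val X) w).
have fP X : X \in A -> [/\ f X \in A, f X != X & val (f X) = symdiff (val X) w].
  rewrite inE => /andP[eX Xe]; have [X' [rX' X'X valX']] := class_translation X.
  have eX' : tog e X' != X' by rewrite -(external_moved exte rX').
  have [Y [eY YX valY]] :
      exists Y, [/\ tog e Y != Y, Y != X & val Y = symdiff (val X) w].
    have [ve|nve] := boolP (e \in v); last first.
      exists X'; split=> //; rewrite valX'; congr symdiff.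
      apply/setP=> y; rewrite in_setD1.
      by have [->|] := eqVneq y e; rewrite ?(negPf nve).
    (* Toggling [e] undoes the change at [e] made by [v]. The result is not [X], for otherwise [e]
       would move [X'] inside its class. *)
    exists (tog e X'); split; first by rewrite moved2.
      apply: contra exte => /eqP eX'X; apply/existsP; exists X'.
      by rewrite eX' eX'X rs.
    rewrite (val_toggle eX') valX' -symdiffA; congr symdiff; apply/setP=> y.
    rewrite in_symdiff in_setD1 in_set1.
    case: eqP => [->|_]; first by rewrite ve.
    by rewrite addbF.
  have -> : f X = Y.
    by apply: val_inj; rewrite /f val_insubd -valY (valP Y).
  by rewrite inE eY YX valY in_symdiff Xe in_setD1 eqxx.
apply: (@even_card_involution _ A f) => X AX; have [fA fX fE] := fP X AX => //.
by apply: val_inj; have [_ _ ->] := fP _ fA; rewrite fE symdiffK.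
Qed.

Lemma external_group_even k : k \in K -> ~~ odd_perm k.
Proof.
rewrite -Alt_even; apply: subsetP; rewrite gen_subG.
apply/subsetP=> g /imsetP[e]; rewrite inE => exte ->.
by rewrite Alt_even external_toggle_even.
Qed.

End SelfTranslation.

(** * Cycles in the external group *)

Lemma no_external_cycle c k :
    (exists X Y, X != Y /\ r X Y) -> c \in K -> is_cycle_of_length k c ->
  k <= 1.
Proof.
move=> [X1 [Y1 [neq rXY]]] Kc [x [cO fixc]]; rewrite leqNgt; apply/negP=> k1.
have cx : c x != x.
  apply: contraTneq k1 => cx; rewrite -cO -leqNgt.
  apply/card_le1_eqP => y z /porbitP[i ->] /porbitP[j ->].
  have fix_iter m : (c ^+ m) x = x by rewrite permX; elim: m => //= m ->.
  by rewrite !fix_iter.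
have [y yx rxy] : exists2 y, y != x & r x y.
  have [g Gg ->] := atransP2 trans (in_setT X1) (in_setT x).
  exists (g Y1); first by rewrite (inj_eq perm_inj) eq_sym.
  by rewrite /= /aperm invr.
(* [c] shifts the class of [x] by a nonempty set, so it fixes nothing there. *)
have Oy : y \in porbit c x.
  apply: contraR cx => /fixc cy; have := external_group_translate Kc rxy.
  rewrite cy symdiffxx => xcx; rewrite -val_eqE.
  by rewrite -(symdiffKl (val x) (val (c x))) xcx symdiff0.
have /porbitP[j yE] := Oy.
have Kd : c ^+ j \in K by rewrite groupX.
rewrite yE in rxy yx.
have even_c := external_group_even Kd rxy yx Kc.
move: even_c; rewrite (odd_perm_cycle fixc) negbK; apply/negP.
(* [c ^+ j] is a fixed-point-free involution of the cycle, so the length is even, while evenness of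
   [c] makes it odd. *)
apply: (@even_card_involution _ _ (c ^+ j)) => z /porbitP[i ->].
- by rewrite -permM -expgD mem_porbit.
- by apply: (self_translation_inv Kd rxy); apply/commuteX2/commute_refl.
- by rewrite -permM -expgD addnC expgD permM (inj_eq perm_inj).
Qed.

End InvariantEquivalence.

Local Close Scope group_scope.

Theorem theorem3p3 (E : finType) (L : {set {set E}}) (n : nat)
    (cardL : #|L| = n)
    (trans : [transitive toggle_group L, on [set: members L] | 'P])
    (cyc : exists (k : nat) (s : {perm members L}),
        s \in toggle_group L /\ is_cycle_of_length k s /\ 2 <= k <= n - 1) :
  [primitive toggle_group L, on [set: members L] | 'P].
Proof.
case: cyc => k [s [Gs [cyc_s /andP[k2 kn]]]].
have kT : k < #|members L|.
  (* Subtraction is truncated, so [n = 0] has to be excluded, by [2 <= k]. *)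
  rewrite card_sig cardL (leq_ltn_trans kn) // subn1 ltn_predL.
  by case: n kn {cardL} => //; rewrite leqNgt (ltnW k2).
apply: primitive_of_equivalences => // r eqr invr nt_r ne_r.
have [X0 fixs] :=
  cycle_fixes_class eqr (fun X Y => invr s X Y Gs) ne_r cyc_s kT.
have Ks := fixes_class_external trans eqr invr Gs fixs.
by have := no_external_cycle trans eqr invr nt_r Ks cyc_s; rewrite leqNgt k2.
Qed.
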